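(* Let $d\ge1$, $n\ge d+1$, and let $(\xi_1,\dots,\xi_n)$ be an exchangeable tuple of random vectors in $\mathbb{R}^d$, i.e. $(\xi_1,\dots,\xi_n)\stackrel{d}{=}(\xi_{\sigma(1)},\dots,\xi_{\sigma(n)})$ for every permutation $\sigma$ of $\{1,\dots,n\}$. Let $S_k=\xi_1+\dots+\xi_k$, $1\le k\le n$. Assume $S_n=0$ a.s. and that any $d$ random vectors among $S_1,\dots,S_{n-1}$ are linearly independent a.s. Then $$\mathbb{P}[0\in\mathrm{Conv}(S_1,\dots,S_{n-1})]=\frac{2}{n!}\left(\left[{n\atop d+2}\right]+\left[{n\atop d+4}\right]+\dots\right),$$ where the Stirling numbers of the first kind $\left[{n\atop k}\right]$ are defined by $t(t+1)\cdots(t+n-1)=\sum_{k=1}^n\left[{n\atop k}\right]t^k$, with $\left[{n\atop k}\right]=0$ for $k\notin\{1,\dots,n\}$.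
   Context: $\mathrm{Conv}$ denotes the convex hull. *)

(* Defs.v *)
From HB Require Import structures.
From mathcomp Require Import all_boot all_order all_algebra fingroup perm.
From mathcomp Require Import all_classical all_reals all_analysis.
Set Implicit Arguments. Unset Strict Implicit. Unset Printing Implicit Defensive.
Import Order.TTheory GRing.Theory Num.Theory.
Local Open Scope classical_set_scope.
Local Open Scope ring_scope.

Definition rising_poly (n : nat) : {poly int} := \prod_(i < n) ('X + (i%:R)%:P).
Definition stirling1 (n k : nat) : int := (rising_poly n)`_k.

(* Product (coordinate) Borel sigma-algebra on n x d real matrices
   (= joint laws of n random vectors in R^d): generated by coordinate preimages
   of Borel sets of R. *)
Definition mx_coord_sets (R : realType) (n d : nat) : set (set 'M[R]_(n, d)) :=
  [set A | exists (i : 'I_n) (j : 'I_d) (B : set R),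
      measurable B /\ A = (fun M : 'M[R]_(n, d) => M i j) @^-1` B].
Definition mx_borel (R : realType) (n d : nat) : set (set 'M[R]_(n, d)) :=
  <<s @mx_coord_sets R n d >>.

Definition tuple_mx (R : realType) (T : Type) (n d : nat)
  (xi : 'I_n -> T -> 'rV[R]_d) (s : {perm 'I_n}) (w : T) : 'M[R]_(n, d) :=
  \matrix_(i < n, j < d) xi (s i) w 0 j.

Definition exchangeable (d0 : measure_display) (T : measurableType d0) (R : realType)
  (P : probability T R) (n d : nat) (xi : 'I_n -> T -> 'rV[R]_d) : Prop :=
  forall (s : {perm 'I_n}) (A : set 'M[R]_(n, d)), @mx_borel R n d A ->
    P (tuple_mx xi 1%g @^-1` A) = P (tuple_mx xi s @^-1` A).

(* partial sums S_k = xi_1 + ... + xi_k  (xi_1 is xi at index 0) *)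
Definition psum (R : realType) (T : Type) (n d : nat)
  (xi : 'I_n -> T -> 'rV[R]_d) (k : nat) (w : T) : 'rV[R]_d :=
  \sum_(i < n | (i < k)%N) xi i w.

Definition in_conv (R : realType) (m d : nat) (p : 'I_m -> 'rV[R]_d) (x : 'rV[R]_d) : Prop :=
  exists lam : 'I_m -> R, (forall k, 0 <= lam k) /\ \sum_k lam k = 1 /\
    \sum_k lam k *: p k = x.

(* Main.v *)
Require Import Defs.
From HB Require Import structures.
From mathcomp Require Import all_boot all_order all_algebra fingroup perm.
From mathcomp Require Import all_classical all_reals all_analysis.
From mathcomp Require Import measurable_realfun.
From mathcomp Require Import zify ring lra.
Set Implicit Arguments. Unset Strict Implicit. Unset Printing Implicit Defensive.
Import Order.TTheory GRing.Theory Num.Theory.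
Local Open Scope classical_set_scope.
Local Open Scope ring_scope.

(**
Write c_i for the tail sums of nonnegative weights a_k on S_1, ..., S_{n-1}:
then sum_k a_k S_k = sum_i c_i xi_i with c_1 >= ... >= c_n = 0.  In general
position 0 lies in the convex hull exactly when the linear relations
{c | sum_i c_i xi_i = 0} contain a strictly decreasing vector, and by
exchangeability the probability is 1/n! times the number N(n, d) of orderings
of {1, ..., n} realised by this space of relations.  This number is
deterministic and satisfies the recursion of Cover for linearly inducible
orderings, N(n+1, d) = N(n, d-1) + n N(n, d): once the other n coefficients are
ordered, the coefficient of a further vector x has one position more than
there are coefficients it can be equal to; dropping x means working modulo x,
and a tie with the i-th coefficient merges x into xi_i.  The Stirling numbers
of the first kind satisfy the same recursion.
*)

(** * Insertions, mergings and permutations of sequences *)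

Section Insertion.
Variable A : Type.
Implicit Types (x : A) (t L : seq A).

Fixpoint ins_at p x t :=
  if p is p'.+1 then if t is y :: t' then y :: ins_at p' x t' else [:: x]
  else x :: t.

(** Orderings are listed with multiplicity, one for each permutation of the positions, so that
    counts stay right when merging makes two entries equal. *)
Fixpoint perms L : seq (seq A) :=
  if L is x :: L' then
    [seq ins_at p x t | t <- perms L', p <- iota 0 (size t).+1]
  else [:: [::]].

Lemma perms_cons x L : perms (x :: L) =
  flatten [seq [seq ins_at p x t | p <- iota 0 (size t).+1] | t <- perms L].
Proof. by []. Qed.

Lemma size_ins_at p x t : size (ins_at p x t) = (size t).+1.
Proof. by elim: t p => [|y t IH] [|p] //=; rewrite IH. Qed.

Lemma big_perms_cons (F : seq A -> nat) x L :
  (\sum_(t <- perms (x :: L)) F t =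
   \sum_(t <- perms L) \sum_(p < (size t).+1) F (ins_at p x t))%N.
Proof.
rewrite perms_cons big_flatten big_map; apply: eq_bigr => t _; rewrite big_map.
by rewrite -(big_mkord xpredT (fun p => F (ins_at p x t))) /index_iota subn0.
Qed.
End Insertion.

Lemma map_ins_at (A B : Type) (f : A -> B) p x t :
  map f (ins_at p x t) = ins_at p (f x) (map f t).
Proof. by elim: t p => [|y t IH] [|p] //=; rewrite IH. Qed.

Lemma perms_map (A B : Type) (f : A -> B) L :
  perms (map f L) = map (map f) (perms L).
Proof.
elim: L => // x L IH; rewrite map_cons !perms_cons IH map_flatten -!map_comp.
congr flatten; apply: eq_map => t.
rewrite /comp -map_comp size_map; apply: eq_map => p.
by rewrite /= map_ins_at.
Qed.

Section PermsEq.
Variable A : eqType.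
Implicit Types (x : A) (t L : seq A).

Lemma perm_ins_at p x t : perm_eq (ins_at p x t) (x :: t).
Proof.
elim: t p => [|y t IH] [|p] //=.
apply: (@perm_trans _ (y :: x :: t)); first by rewrite perm_cons.
by rewrite -!(cat1s _ (_ :: _)) (perm_catCA [:: y] [:: x] t).
Qed.

Lemma ins_at_index x t : x \in t -> ins_at (index x t) x (rem x t) = t.
Proof.
elim: t => //= y t IH; rewrite inE eq_sym.
by case: eqVneq => [->//|_ /= /IH ->].
Qed.

Lemma mem_perms L t : (t \in perms L) = perm_eq t L.
Proof.
elim: L t => [|x L IH] t.
  by rewrite inE; apply/eqP/idP => [->//|/perm_nilP].
rewrite perms_cons.
apply/flatten_mapP/idP => [[u uL /mapP[p _ ->]]|tL].
  by rewrite (perm_trans (perm_ins_at p x u)) // perm_cons -IH.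
have xt : x \in t by rewrite (perm_mem tL) mem_head.
exists (rem x t); last first.
  apply/mapP; exists (index x t); last by rewrite ins_at_index.
  rewrite mem_iota add0n leq0n ltnS size_rem // -ltnS prednK ?index_mem//.
  by case: (t) xt.
by rewrite IH -(perm_cons x) (perm_trans _ tL) // perm_sym perm_to_rem.
Qed.

Lemma size_perms L : size (perms L) = (size L)`!.
Proof.
elim: L => // x L IH; rewrite perms_cons size_flatten /shape -map_comp factS -IH.
rewrite (_ : map _ _ = [seq (size L).+1 | t <- perms L]); last first.
  apply/eq_in_map => t; rewrite mem_perms => /perm_size <-.
  by rewrite [LHS]size_map size_iota.
by elim: (perms L) => [|u s /= ->]; rewrite ?muln0 ?mulnS.
Qed.
End PermsEq.

(** For the duplicate-free list of indices, the length [n!] forces every permutation to occur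
    exactly once; [perms_map] carries this over to vectors that may coincide. *)
Lemma big_perms_enum (A : Type) n (x : 'I_n -> A) (F : seq A -> nat) :
  (\sum_(t <- perms [seq x i | i <- enum 'I_n]) F t =
   \sum_(s : {perm 'I_n}) F [seq x (s i) | i <- enum 'I_n])%N.
Proof.
rewrite perms_map big_map.
pose g (s : {perm 'I_n}) := [seq s i | i <- enum 'I_n].
have ginj : injective g.
  by move=> s s' /eq_in_map e; apply/permP => i; apply: e; rewrite mem_enum.
have ug : uniq (map g (enum {perm 'I_n})) by rewrite map_inj_uniq ?enum_uniq.
have sub : {subset map g (enum {perm 'I_n}) <= perms (enum 'I_n)}.
  move=> _ /mapP[s _ ->]; rewrite mem_perms.
  apply: uniq_perm; rewrite ?enum_uniq//.
    by rewrite map_inj_uniq ?enum_uniq//; exact: perm_inj.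
  move=> i; rewrite mem_enum inE; apply/mapP; exists ((s^-1)%g i); rewrite ?mem_enum//.
  by rewrite permKV.
have sz : (size (perms (enum 'I_n)) <= size (map g (enum {perm 'I_n})))%N.
  by rewrite size_map size_perms size_enum_ord -card_Sn -cardT.
have [_ eqi] := uniq_min_size ug sub sz.
have up := leq_size_uniq ug sub sz.
rewrite -(perm_big _ (uniq_perm ug up eqi)) big_map big_enum /=.
by apply: eq_bigr => s _; rewrite -map_comp.
Qed.

(** * Merging a vector into an entry *)

Section Merge.
Variable V : nmodType.
Implicit Types (x : V) (t L : seq V).

Fixpoint mrg_at i x t :=
  if t is y :: t' then
    if i is i'.+1 then y :: mrg_at i' x t' else (y + x) :: t'
  else [::].

Lemma size_mrg_at i x t : size (mrg_at i x t) = size t.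
Proof. by elim: t i => [|y t IH] [|i] //=; rewrite IH. Qed.

Lemma mrg_ins_at p x y t : mrg_at p x (ins_at p y t) = ins_at p (y + x) t
  \/ (size t < p)%N.
Proof.
elim: t p => [|z t IH] [|p] /=; [by left|by right|by left|].
by case: (IH p) => [->|]; [left|right].
Qed.

Lemma mrg_ins_at_bump p i x y t : (p <= size t)%N ->
  mrg_at (bump p i) x (ins_at p y t) = ins_at p y (mrg_at i x t).
Proof.
elim: t p i => [|z t IH] [|p] [|i] //= pt; rewrite bumpS /= IH //.
Qed.

(** Double counting: the entry that absorbs [x] may be chosen before or after ordering. In the
    induction it is either the entry just inserted or an older one, whose index is shifted by
    [bump]. *)
Lemma big_perms_mrg (F : seq V -> nat) x L :
  (\sum_(t <- perms L) \sum_(i < size t) F (mrg_at i x t) =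
   \sum_(i < size L) \sum_(t <- perms (mrg_at i x L)) F t)%N.
Proof.
elim: L F => [|y L IH] F; first by rewrite big_seq1 !big_ord0.
rewrite [RHS]big_ord_recl /= [X in (X + _)%N]big_perms_cons big_perms_cons.
under [X in (_ + X)%N]eq_bigr => i _ do rewrite /= big_perms_cons.
rewrite -(IH (fun u => \sum_(p < (size u).+1) F (ins_at p y u))%N).
rewrite -big_split /=; apply: eq_bigr => t _.
under [X in (_ + X)%N]eq_bigr => i _ do rewrite size_mrg_at.
rewrite [X in (_ + X)%N]exchange_big -big_split /=; apply: eq_bigr => p _.
rewrite size_ins_at (bigD1_ord p) //=; congr (F _ + _)%N.
  by case: (mrg_ins_at p x y t) => //; rewrite ltnNge -ltnS ltn_ord.
by apply: eq_bigr => i _; rewrite mrg_ins_at_bump // -ltnS.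
Qed.

Lemma sum_mrg_at i x t : (i < size t)%N ->
  \sum_(y <- mrg_at i x t) y = x + \sum_(y <- t) y.
Proof.
elim: t i => [|y t IH] [|i] //= it; rewrite !big_cons.
  by rewrite addrAC addrC addrA addrC addrA.
by rewrite IH // addrCA.
Qed.
End Merge.

(** * Positions of a linear functional in an ordering *)

Lemma small_perturb (R : realFieldType) (I : finType) (f g : I -> R) :
  (forall i, 0 < f i) ->
  exists2 e : R, 0 < e & forall h : R, `|h| <= e -> forall i, 0 < f i + h * g i.
Proof.
move=> f0; pose S := 1 + \sum_i `|g i| / f i.
have ge0 i : 0 <= `|g i| / f i by rewrite divr_ge0 // ltW.
have S0 : 0 < S by rewrite ltr_pwDl // sumr_ge0.
exists S^-1; first by rewrite invr_gt0.
move=> h he i; rewrite addrC -ltrBlDr sub0r.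
have : `|h * g i| < f i.
  rewrite normrM (@le_lt_trans _ _ (S^-1 * `|g i|)) ?ler_wpM2r //.
  rewrite mulrC ltr_pdivrMr // mulrC -ltr_pdivrMr //.
  rewrite /S (bigD1 i) //= ltr_pwDl // lerDl sumr_ge0 //.
by rewrite ltr_norml => /andP[].
Qed.

Section Crossing.
Variable R : realFieldType.
Implicit Types (c u : nat -> R) (e s : R).

Definition decreasing n c := forall i j, (i < j < n)%N -> c j < c i.

Lemma decreasing_perturb n c u : decreasing n c ->
  exists2 e : R, 0 < e & forall h : R, `|h| <= e -> decreasing n (fun i => c i + h * u i).
Proof.
move=> dc.
have [|e e0 he] := @small_perturb R ('I_n * 'I_n)%type
  (fun p => if (p.1 < p.2)%N then c p.1 - c p.2 else 1)
  (fun p => if (p.1 < p.2)%N then u p.1 - u p.2 else 0).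
  move=> [i j] /=; case: ifP => // ij; rewrite subr_gt0 dc //.
  by rewrite ij ltn_ord.
exists e => // h /he {}he i j /andP[ij jn].
have := he (Ordinal (ltn_trans ij jn), Ordinal jn); rewrite /= ij; lra.
Qed.

(** Read [K c e] as a relation in which [c] gives the ordered coefficients of [n] vectors and [e]
    that of one more. By [K_open] a tie can be left in both directions: along [(u, s)] the
    difference of [e] and [c i] moves at unit speed. *)
Variables (n : nat) (K : (nat -> R) -> R -> Prop).
Hypothesis K_dec : forall c e, K c e -> decreasing n c.
Hypothesis K_cone : forall c e c' e' (a b : R), 0 < a -> 0 < b -> K c e -> K c' e' ->
  K (fun i => a * c i + b * c' i) (a * e + b * e').
Hypothesis K_open : forall c e i, (i < n)%N -> K c e -> e = c i ->
  exists u s, s = u i + 1 /\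
    (exists2 h : R, 0 < h & forall k : R, `|k| <= h -> K (fun i => c i + k * u i) (e + k * s)).

Let above i := `[< exists c e, K c e /\ c i < e >].
Let below i := `[< exists c e, K c e /\ e < c i >].

Let tie i := `[< exists c e, K c e /\ e = c i >].
Let fits p := `[< exists c e, [/\ K c e, (0 < p)%N -> e < c p.-1 &
                                (p < n)%N -> c p < e] >].

Let tie_split i : (i < n)%N -> tie i -> above i /\ below i.
Proof.
move=> lin /asboolP[c [e [Kce ei]]].
have [u [s [us [h h0 Kh]]]] := K_open lin Kce ei.
split; apply/asboolP.
  exists (fun i => c i + h * u i), (e + h * s); split; last by rewrite us ei; nra.
  by apply: Kh; rewrite gtr0_norm.
exists (fun i => c i + (- h) * u i), (e + (- h) * s); split; last by rewrite us ei; nra.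
by apply: Kh; rewrite normrN gtr0_norm.
Qed.

Let tieE i : (i < n)%N -> tie i = above i && below i.
Proof.
move=> lin; apply/idP/andP => [/(tie_split lin)//|[]].
move=> /asboolP[c [e [Kce lt1]]] /asboolP[c' [e' [Kce' lt2]]]; apply/asboolP.
(* Each witness is weighted by the gap of the other, so the gaps cancel. *)
exists (fun j => (c' i - e') * c j + (e - c i) * c' j),
       ((c' i - e') * e + (e - c i) * e'); split; last by ring.
by apply: K_cone => //; rewrite subr_gt0.
Qed.

(** The two inequalities around position [p] may come from separate witnesses. If neither witness
    meets both, one has [e] at or above the gap and the other at or below it, and a positive
    combination lands inside. *)
Let fitsE p : (p <= n)%N -> (exists c e, K c e) ->
  fits p = ((0 < p)%N ==> below p.-1) && ((p < n)%N ==> above p).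
Proof.
move=> pn [c0 [e0 K0]]; apply/asboolP/andP => [[c [e [Kce lo hi]]]|[]].
  split; apply/implyP => ?; apply/asboolP; exists c, e; split; auto.
case: posnP => [-> _|p0 /implyP/(_ isT) /asboolP[c2 [e2 [K2 lt2]]]].
  case: posnP => [n0 _|nn /implyP/(_ isT) /asboolP[c [e [Kce lt1]]]].
    by exists c0, e0; split; rewrite ?n0.
  by exists c, e.
move: pn; rewrite leq_eqVlt => /orP[/eqP pn _|pn].
  by exists c2, e2; split; rewrite // pn ltnn.
move=> /implyP/(_ pn) /asboolP[c1 [e1 [K1 lt1]]].
have pp : (p.-1 < p < n)%N by rewrite prednK // leqnn.
have d1 := K_dec K1 pp; have d2 := K_dec K2 pp.
have [g2|g2] := ltP (c2 p) e2; first by exists c2, e2.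
have [g1|g1] := ltP e1 (c1 p.-1); first by exists c1, e1.
(* Combine the two witnesses so that [e] becomes the midpoint of [c p] and [c p.-1]. *)
pose h1 := 2 * e1 - c1 p - c1 p.-1; pose h2 := c2 p + c2 p.-1 - 2 * e2.
have h10 : 0 < h1 by rewrite /h1; lra.
have h20 : 0 < h2 by rewrite /h2; lra.
exists (fun j => h2 * c1 j + h1 * c2 j), (h2 * e1 + h1 * e2).
have K3 := K_cone h20 h10 K1 K2; have /= d3 := K_dec K3 pp.
have E : 2 * (h2 * e1 + h1 * e2) =
  (h2 * c1 p + h1 * c2 p) + (h2 * c1 p.-1 + h1 * c2 p.-1) by rewrite /h1 /h2; ring.
by split => // _; lra.
Qed.

(** Every index is [above] or [below], and tied exactly when it is both; an inner position [p] fits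
    exactly when [above p] and [below p.-1] hold. By inclusion and exclusion the two counts agree
    except at the ends, where positions 0 and [n] each have one constraint less; this leaves the
    1. *)
Lemma count_crossings : (exists c e, K c e) ->
  (\sum_(p < n.+1) fits p = 1 + \sum_(i < n) tie i)%N.
Proof.
move=> K0.
have cover i : (i < n)%N -> above i || below i.
  move=> lin; have [c [e Kce]] := K0.
  have [lt|gt|eq] := ltgtP e (c i).
  - by apply/orP; right; apply/asboolP; exists c, e.
  - by apply/orP; left; apply/asboolP; exists c, e.
  - by have [|->] := @tie_split i lin; first by apply/asboolP; exists c, e.
have E1 p : (p < n.+1)%N -> (fits p + 1 = ((p < n)%N ==> above p) + ((0 < p)%N ==> below p.-1))%N.
  rewrite ltnS => pn; rewrite fitsE //.
  suff : ((p < n)%N ==> above p) || ((0 < p)%N ==> below p.-1).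
    by case: (_ ==> above p); case: (_ ==> below p.-1).
  case: ltnP => //= pn'; case: posnP => [->|p0] /=; first by rewrite orbT.
  have [//|nab] := boolP (above p).
  have := cover p.-1; rewrite (leq_ltn_trans (leq_pred p) pn') => /(_ isT).
  case/orP => // ab; move: (cover p pn'); rewrite (negbTE nab) /=.
  move=> /asboolP[c [e [Kce lt]]]; apply/asboolP; exists c, e; split => //.
  by rewrite (lt_trans lt) // (K_dec Kce) // prednK // leqnn.
have E2 i : (i < n)%N -> (tie i + 1 = above i + below i)%N.
  by move=> lin; rewrite tieE //; move: (cover i lin); case: above; case: below.
have S1 : (\sum_(p < n.+1) (fits p + 1) = \sum_(i < n) above i + 1 + (1 + \sum_(i < n) below i))%N.
  rewrite (eq_bigr _ (fun (p : 'I_n.+1) _ => E1 p (ltn_ord p))) big_split /=; congr addn.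
    rewrite big_ord_recr /= ltnn; congr addn.
    by apply: eq_bigr => i _; rewrite ltn_ord.
  by rewrite big_ord_recl /=.
have S2 : (\sum_(i < n) (tie i + 1) = \sum_(i < n) above i + \sum_(i < n) below i)%N.
  by rewrite (eq_bigr _ (fun (p : 'I_n) _ => E2 p (ltn_ord p))) big_split.
move: S1 S2; rewrite !big_split /= !sum_nat_const !card_ord !muln1; lia.
Qed.
End Crossing.

(** * Linearly inducible orderings *)

Section Inducible.
Variables (R : realFieldType) (V : vectType R).
Implicit Types (c u : nat -> R) (x : V) (t L : seq V) (W : {vspace V}).

Definition dot c t := \sum_(i < size t) c i *: t`_i.

(** Relations are taken modulo [W], which collects the vectors dropped so far in the recursion. *)
Definition inducible W t :=
  `[< exists c, decreasing (size t) c /\ dot c t \in W >].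

Lemma dot_cons c x t : dot c (x :: t) = c 0%N *: x + dot (c \o S) t.
Proof. by rewrite /dot big_ord_recl. Qed.

Lemma dot_ext c u t : (forall i, (i < size t)%N -> c i = u i) -> dot c t = dot u t.
Proof. by move=> e; apply: eq_bigr => i _; rewrite e. Qed.

Lemma dot_comb c u (a b : R) t :
  dot (fun i => a * c i + b * u i) t = a *: dot c t + b *: dot u t.
Proof.
by rewrite /dot !scaler_sumr -big_split; apply: eq_bigr => i _; rewrite scalerDl !scalerA.
Qed.

Lemma dot_ins_at p x t c : (p <= size t)%N ->
  dot c (ins_at p x t) = c p *: x + dot (c \o bump p) t.
Proof.
elim: t p c => [|y t IH] [|p] c //= pt; rewrite !dot_cons //.
rewrite IH //= addrCA; congr (_ + (_ + _)); apply: dot_ext => i _.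
by rewrite /= bumpS.
Qed.

Lemma dot_mrg_at i x t c : (i < size t)%N ->
  dot c (mrg_at i x t) = c i *: x + dot c t.
Proof.
elim: t i c => [|y t IH] [|i] c //= it; rewrite !dot_cons.
  by rewrite scalerDr addrAC addrC addrA addrC addrA.
by rewrite IH // addrCA.
Qed.

(** Here and in the next two lemmas the data are a decreasing [c] on [t] and a coefficient [e] of
    [x]: it falls into the [p]-th gap, or equals [c i] when [x] is merged, or is free when one works
    modulo [x]. *)
Lemma inducible_ins_at W p x t : (p <= size t)%N ->
  inducible W (ins_at p x t) =
  `[< exists c e, [/\ decreasing (size t) c /\ e *: x + dot c t \in W,
      (0 < p)%N -> e < c p.-1 & (p < size t)%N -> c p < e] >].
Proof.
move=> pt; apply/asboolP/asboolP; rewrite ?size_ins_at.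
  move=> [c [dc cW]]; exists (c \o bump p), (c p); split.
  - split; last by rewrite -dot_ins_at.
    by move=> i j ij /=; apply: dc; rewrite /bump; lia.
  - by move=> p0 /=; apply: dc; rewrite /bump; lia.
  - by move=> pn /=; apply: dc; rewrite /bump; lia.
move=> [c [e [[dc cW] lo hi]]].
pose c' i := if (i < p)%N then c i else if i == p then e else c i.-1.
have c'p : c' p = e by rewrite /c' ltnn eqxx.
exists c'; split; last first.
  rewrite dot_ins_at // c'p (dot_ext (u := c)) // => i _.
  rewrite /= /c' /bump; case: (leqP p i) => pi /=.
    by rewrite ifF 1?ifF //; lia.
  by rewrite add0n pi.
have mono i j : (i < j < size t)%N -> c j < c i by exact: dc.
move=> i j /andP[ij jn]; rewrite /c'.
have [ip|ip|ip] := ltngtP i p; have [jp|jp|jp] := ltngtP j p; try lia; try (apply: dc; lia).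
- have l : e < c p.-1 by apply: lo; lia.
  have [->//|ne] := eqVneq i p.-1.
  by apply: (lt_trans l); apply: dc; lia.
- have l : c p < e by apply: hi; lia.
  have [<-//|ne] := eqVneq p j.-1.
  by apply: lt_trans l; apply: dc; lia.
Qed.

Lemma inducible_mrg_at W i x t : (i < size t)%N ->
  inducible W (mrg_at i x t) =
  `[< exists c e, (decreasing (size t) c /\ e *: x + dot c t \in W) /\ e = c i >].
Proof.
move=> it; apply/asboolP/asboolP; rewrite size_mrg_at.
  by move=> [c [dc]]; rewrite dot_mrg_at // => cW; exists c, (c i).
by move=> [c [e [[dc cW] ei]]]; exists c; rewrite dot_mrg_at // -ei.
Qed.

Lemma inducible_addv W x t :
  inducible (W + <[x]>)%VS t =
  `[< exists c e, decreasing (size t) c /\ e *: x + dot c t \in W >].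
Proof.
apply/asboolP/asboolP.
  move=> [c [dc /memv_addP[w wW [_ /vlineP[k ->] e]]]]; exists c, (- k).
  by split => //; rewrite e scaleNr addrCA addNr addr0.
move=> [c [e [dc cW]]]; exists c; split => //; apply/memv_addP.
exists (e *: x + dot c t) => //; exists ((- e) *: x).
  by rewrite memvZ // memv_line.
by rewrite scaleNr addrAC subrr add0r.
Qed.

(* A colouring of [L] is encoded by the sequence [P] of pairs (colour, vector),
   taken in any order so that the condition is invariant under permutations. *)
Definition gen_pos d W L := forall P : seq (nat * V), perm_eq (unzip2 P) L ->
  {subset iota 0 d.+1 <= unzip1 P} ->
  forall v, exists w : nat -> R, v - \sum_(p <- P) w p.1 *: p.2 \in W.

Lemma gen_pos_perm d W L L' : perm_eq L L' -> gen_pos d W L -> gen_pos d W L'.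
Proof. by move=> LL' gL P PL'; apply: gL; rewrite (perm_trans PL') // perm_sym. Qed.

(** [gen_pos d W L] says that the colour class sums span everything modulo [W] as soon as the
    colours 0 to [d] all occur. Giving [x] a colour of its own adds one colour, and its class
    disappears modulo [x]. *)
Lemma gen_pos_drop d W x L : gen_pos d.+1 W (x :: L) -> gen_pos d (W + <[x]>)%VS L.
Proof.
move=> g P PL sub v.
have [||w hw] := g ((0%N, x) :: [seq (p.1.+1, p.2) | p <- P]) _ _ v.
- by rewrite /= perm_cons /unzip2 -map_comp.
- move=> k; rewrite /= inE -/(iota 1 d.+1) => /orP[/eqP->|]; first by rewrite mem_head.
  rewrite (iotaDl 1 0) => /mapP[j /sub /mapP[q qP ->] ->]; rewrite inE /=.
  by apply/mapP; exists (q.1.+1, q.2) => //; apply/mapP; exists q.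
exists (w \o S); move: hw; rewrite big_cons big_map /= => hw.
apply/memv_addP; exists (v - (w 0%N *: x + \sum_(j <- P) w j.1.+1 *: j.2)) => //.
exists (w 0%N *: x); first by rewrite memvZ // memv_line.
by rewrite opprD addrCA addrC subrK.
Qed.

Lemma perm_mrg_at i x t : (i < size t)%N ->
  exists y t', perm_eq t (y :: t') /\ perm_eq (mrg_at i x t) ((y + x) :: t').
Proof.
elim: t i => [|z t IH] [|i] //= it; first by exists z, t.
have [y [t' [p1 p2]]] := IH i it; exists y, (z :: t').
split; first by apply: perm_trans (permEl (perm_catCA [:: z] [:: y] t')); rewrite perm_cons.
by apply: perm_trans (permEl (perm_catCA [:: z] [:: y + x] t')); rewrite /= perm_cons.
Qed.

(** Splitting the merged entry into [x] and [y] of the same colour leaves all class sums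
    unchanged. *)
Lemma gen_pos_mrg d W i x t : (i < size t)%N ->
  gen_pos d W (x :: t) -> gen_pos d W (mrg_at i x t).
Proof.
move=> it g; have [y [t' [p1 p2]]] := perm_mrg_at x it.
apply: (@gen_pos_perm _ _ ((y + x) :: t')); first by rewrite perm_sym.
have {}g : gen_pos d W [:: x, y & t'].
  by apply: gen_pos_perm g; rewrite perm_cons.
move=> P PL sub v.
have : y + x \in unzip2 P by rewrite (perm_mem PL) mem_head.
case/mapP => -[k z] kP /= zE; rewrite -{}zE in kP.
have PP := perm_to_rem kP.
have PL' : perm_eq (unzip2 (rem (k, y + x) P)) t'.
  rewrite -(perm_cons (y + x)) -(permPr PL) perm_sym.
  by rewrite (permPl (perm_map _ PP)).
have [||w hw] := g [:: (k, x), (k, y) & rem (k, y + x) P] _ _ v.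
- by rewrite /= !perm_cons.
- by move=> j /sub; rewrite (perm_mem (perm_map _ PP)) /= !inE orbA orbb.
exists w; rewrite (perm_big _ PP) big_cons /=.
by move: hw; rewrite !big_cons /= scalerDr addrA (addrC (w k *: x)).
Qed.

(** Colour the entries of [t] by their index and [x] like the [i]-th one. Writing [x] through the
    class sums gives a relation in which the coefficient of [x] exceeds that of the [i]-th entry by
    1, as [K_open] requires. *)
Lemma gen_pos_indep d W x t i : (d < size t)%N -> (i < size t)%N ->
  gen_pos d W (x :: t) -> exists u s, s = u i + 1 /\ s *: x + dot u t \in W.
Proof.
move=> dt it g.
have [||w hw] := g ((i, x) :: zip (iota 0 (size t)) t) _ _ x.
- by rewrite /= unzip2_zip ?size_iota.
- move=> k; rewrite mem_iota => kd; rewrite /= unzip1_zip ?size_iota //.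
  by rewrite inE mem_iota; apply/orP; right; lia.
exists (fun j => - w j), (1 - w i); split; first by rewrite addrC.
move: hw; rewrite big_cons /= scalerBl scale1r opprD addrA.
suff -> : \sum_(j <- zip (iota 0 (size t)) t) w j.1 *: j.2 = dot w t.
  suff -> : dot (fun j => - w j) t = - dot w t by [].
  by rewrite /dot -sumrN; apply: eq_bigr => j _; rewrite scaleNr.
rewrite (big_nth (0%N, 0)) big_mkord size_zip size_iota minnn.
by apply: eq_bigr => j _; rewrite nth_zip ?size_iota //= nth_iota.
Qed.

(** In [count_crossings] the positions become insertions, the ties mergings, and the 1 inducibility
    modulo [x]. If no pair [c], [e] satisfies [K], every term is 0. *)
Lemma count_ins_at d W x t : (d < size t)%N -> gen_pos d W (x :: t) ->
  (\sum_(p < (size t).+1) inducible W (ins_at p x t) =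
   inducible (W + <[x]>)%VS t + \sum_(i < size t) inducible W (mrg_at i x t))%N.
Proof.
move=> dt g; rewrite inducible_addv.
under eq_bigr => p _ do rewrite inducible_ins_at -1?ltnS //.
under [in RHS]eq_bigr => i _ do rewrite inducible_mrg_at //.
pose K c (e : R) := decreasing (size t) c /\ e *: x + dot c t \in W.
have [ex|nex] := asboolP.
  apply: (@count_crossings _ _ K) => // [c e []//|c e c' e' a b a0 b0 [dc cW] [dc' cW']|].
    split; first by move=> i j ij; rewrite ltrD // ltr_pM2l // ?dc ?dc'.
    rewrite dot_comb scalerDl -!scalerA addrACA -!scalerDr.
    by rewrite memvD // memvZ.
  move=> c e i it [dc cW] _.
  have [u [s [us uW]]] := gen_pos_indep dt it g.
  exists u, s; split => //.
  have [h h0 hh] := decreasing_perturb u dc; exists h => // k /hh dk; split => //.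
  have -> : dot (fun j => c j + k * u j) t = dot c t + k *: dot u t.
    by rewrite -[dot c t]scale1r -dot_comb; apply: dot_ext => j _; rewrite mul1r.
  by rewrite scalerDl -scalerA addrACA -scalerDr memvD // memvZ.
rewrite !big1 // => [i _|p _]; apply/eqP; rewrite eqb0; apply/asboolPn.
  by move=> [c [e [? _]]]; apply: nex; exists c, e.
by move=> [c [e [? _ _]]]; apply: nex; exists c, e.
Qed.

(** With a single colour the only class sum is the total, which vanishes modulo [W]. *)
Lemma gen_pos_full W L : (0 < size L)%N -> gen_pos 0 W L ->
  \sum_(x <- L) x \in W -> W = fullv.
Proof.
move=> L0 g sW; apply/eqP; rewrite eqEsubv subvf; apply/subvP => v _.
have [||w hw] := g [seq (0%N, x) | x <- L] _ _ v.
- by rewrite /unzip2 -map_comp map_id_in.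
- move=> k; rewrite inE => /eqP ->; rewrite /unzip1 -map_comp.
  by case: L L0 {g sW} => //= x L _; rewrite mem_head.
move: hw; rewrite big_map /= -scaler_sumr => hw.
by rewrite -(subrK (w 0%N *: \sum_(x <- L) x) v) memvD // memvZ.
Qed.

(** Subtracting the last coefficient times the total removes [z] but not [x], since the first
    coefficient is larger; so [x], and by the total also [z], lies in [W] plus the span of the [d]
    middle vectors. By general position this is all of [V], against the dimension bound. *)
Lemma inducible_minimal d W t : size t = d.+2 -> (\dim W + d.+1 <= \dim {:V})%N ->
  gen_pos d.+1 W t -> \sum_(x <- t) x \in W -> inducible W t = false.
Proof.
move=> st dW g sW; apply/asboolPn => -[c [dc cW]].
case: t st g sW dc cW => // x t [st] g sW dc cW.
case/lastP: t st g sW dc cW => // m z; rewrite size_rcons => -[st] g sW dc cW.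
pose U := (W + <<m>>)%VS.
have WU : (W <= U)%VS by exact: addvSl.
have inm i : (i < size m)%N -> m`_i \in U.
  by move=> im; rewrite (subvP (addvSr _ _)) // memv_span // mem_nth.
have xU : x \in U.
  pose a := c d.+1.
  have : dot c (x :: rcons m z) - a *: \sum_(y <- x :: rcons m z) y \in U.
    by rewrite memvB ?memvZ // (subvP WU).
  rewrite (big_nth 0) big_mkord scaler_sumr /dot -sumrB /= size_rcons.
  rewrite big_ord_recl big_ord_recr /= nth_rcons st ltnn eqxx.
  rewrite -/a subrr addr0 -scalerBl => h.
  have : (c 0%N - a) *: x \in U.
    rewrite -(addrK (\sum_(i < d) (c (bump 0 i) *: (rcons m z)`_i - a *: (rcons m z)`_i)) (_ *: x)).
    rewrite memvB // memv_suml // => i _; rewrite -scalerBl memvZ //.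
    by rewrite nth_rcons st ltn_ord inm // st.
  have ne : c 0%N - a != 0.
    by rewrite subr_eq0 gt_eqF // dc //= size_rcons st ltnS leqnn.
  by move/(memvZ (c 0%N - a)^-1); rewrite scalerA mulVf // scale1r.
have zU : z \in U.
  have : \sum_(y <- x :: rcons m z) y \in U by exact: (subvP WU).
  rewrite big_cons big_rcons /= addrCA => h.
  have h2 : x + \sum_(i <- m) i \in U.
    rewrite memvD // big_seq memv_suml // => y ym.
    by rewrite (subvP (addvSr _ _)) // memv_span.
  by move: (memvB h h2); rewrite addrCA addrA (addrC (x + _)) addrK.
have UT : (fullv <= U)%VS.
  apply/subvP => v _.
  have [||w hw] := g (zip (iota 0 d.+2) (x :: rcons m z)) _ _ v.
  - by rewrite unzip2_zip ?size_iota //= size_rcons st.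
  - by move=> k; rewrite unzip1_zip ?size_iota //= size_rcons st.
  rewrite -(subrK (\sum_(p <- zip (iota 0 d.+2) (x :: rcons m z)) w p.1 *: p.2) v).
  rewrite memvD //; first exact: (subvP WU).
  rewrite big_seq memv_suml // => p pz; rewrite memvZ //.
  have : p.2 \in unzip2 (zip (iota 0 d.+2) (x :: rcons m z)) by exact: map_f.
  rewrite unzip2_zip ?size_iota //= ?size_rcons ?st // inE mem_rcons inE.
  case/or3P => [/eqP->|/eqP->|pm] //.
  by rewrite (subvP (addvSr _ _)) // memv_span.
have := dimvS UT; have := dimv_add_leqif W <<m>>%VS => /= -[h _].
have := dim_span m; rewrite st; rewrite -/U in h; lia.
Qed.
End Inducible.

(** * Stirling numbers and the recursion *)

Section Stirling.

Definition stirling_sum n d : int :=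
  \sum_(k < n.+1 | (d.+2 <= k)%N && ~~ odd (k - d)) stirling1 n k.

Lemma size_rising_poly n : (size (rising_poly n) <= n.+1)%N.
Proof.
have := size_prod_XsubC (enum 'I_n) (fun i : 'I_n => - (i%:R : int)).
rewrite /rising_poly size_enum_ord big_enum /=.
by under eq_bigr => i _ do rewrite polyCN opprK; move=> ->.
Qed.

Lemma stirling1_gt n k : (n < k)%N -> stirling1 n k = 0.
Proof.
by move=> nk; apply/leq_sizeP: nk; exact: size_rising_poly.
Qed.

Lemma stirling1SS n k : stirling1 n.+1 k.+1 = stirling1 n k + n%:R * stirling1 n k.+1.
Proof.
by rewrite /stirling1 /rising_poly big_ord_recr /= mulrDr coefD coefMX coefMC mulrC.
Qed.

Lemma stirling_sumSS n d :
  stirling_sum n.+1 d.+1 = stirling_sum n d + n%:R * stirling_sum n d.+1.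
Proof.
rewrite /stirling_sum big_mkcond big_ord_recl /= add0r.
under eq_bigr => k _ do rewrite /bump /= add1n ltnS subSS stirling1SS.
rewrite -big_mkcond big_split /=; congr (_ + _).
rewrite -mulr_sumr; congr (_ * _).
rewrite [RHS]big_mkcond [RHS]big_ord_recl /= add0r.
rewrite [LHS]big_mkcond [LHS]big_ord_recr /= stirling1_gt // if_same addr0.
by apply: eq_bigr => k _; rewrite /bump /= add1n subSS.
Qed.

Lemma stirling_sum_small n d : (n <= d.+1)%N -> stirling_sum n d = 0.
Proof.
move=> nd; rewrite /stirling_sum big1 // => k /andP[dk _].
by have := ltn_ord k; lia.
Qed.

Lemma horner_rising n (x : int) : (rising_poly n).[x] = \prod_(i < n) (x + i%:R).
Proof. by rewrite horner_prod; apply: eq_bigr => i _; rewrite !hornerE. Qed.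

(* The even part of the rising factorial, from its values at [1] and [-1]. *)
Lemma stirling_sum0 n : (1 < n)%N -> 2 * stirling_sum n 0 = (n`!)%:R.
Proof.
move=> n1.
have e1 : (rising_poly n).[1] = (n`!)%:R.
  rewrite horner_rising fact_prod natr_prod big_add1 big_mkord.
  by apply: eq_bigr => i _; rewrite -natr1 addrC.
have e2 : (rising_poly n).[-1] = 0.
  by rewrite horner_rising (bigD1 (Ordinal n1)) //= addNr mul0r.
have z0 : stirling1 n 0 = 0.
  rewrite /stirling1 -horner_coef0 horner_rising.
  by rewrite (bigD1 (Ordinal (ltnW n1))) //= addr0 mul0r.
move: e1 e2; rewrite !(horner_coef_wide _ (size_rising_poly n)) => e1 e2.
have := congr2 +%R e1 e2; rewrite addr0 => <-; rewrite -big_split /= mulr_sumr big_mkcond /=.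
apply: eq_bigr => k _; rewrite expr1n mulr1 -signr_odd subn0 -/(stirling1 n k).
have [k1|] := ltnP 1 k.
  by case: (odd k); rewrite /= ?expr1 ?expr0 ?mulrN1 ?mulr1 ?subrr //; lia.
case: (nat_of_ord k) => [|[]] //= _; first by rewrite z0 mul0r addr0.
by rewrite expr1 mulrN1 subrr.
Qed.
End Stirling.

(** * Counting inducible orderings *)

Section Count.
Variables (R : realFieldType) (V : vectType R).
Implicit Types (x : V) (t L : seq V) (W : {vspace V}).

(** Induction on the length. For [d = 0] the space [W] is everything and all orderings count; when
    [size L = d + 1] none does. Otherwise the sum over the positions of the first vector [x] splits
    into one count modulo [x] and one for each merging, which is the recursion [stirling_sumSS]. *)
Theorem count_inducible d W L : (1 < size L)%N -> (d < size L)%N ->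
  (\dim W + d <= \dim {:V})%N -> \sum_(x <- L) x \in W -> gen_pos d W L ->
  (\sum_(t <- perms L) inducible W t)%:Z = 2 * stirling_sum (size L) d.
Proof.
move En : (size L) => n.
elim: n d W L En => // n IH d W L En n1 dn dW sW g.
case: d dn dW g => [|d] dn dW g.
  have WV : W = fullv by apply: gen_pos_full g sW; rewrite En.
  rewrite stirling_sum0 // -En -size_perms natz -sum1_size; congr Posz.
  apply: eq_bigr => t _; suff -> : inducible W t by [].
  apply/asboolP; exists (fun i => - i%:R); split; last by rewrite WV memvf.
  by move=> i j /andP[ij _]; rewrite ltrN2 ltr_nat.
move: dn; rewrite ltnS leq_eqVlt => /orP[/eqP dn|dn].
  rewrite stirling_sum_small ?dn // mulr0 big_seq big1 // => t.
  rewrite mem_perms perm_sym => Lt; rewrite (inducible_minimal _ dW) //.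
  - by rewrite -(perm_size Lt) En dn.
  - exact: gen_pos_perm g.
  - by rewrite -(perm_big _ Lt).
case: L En sW g => // x L [En] sW g.
have step t : t \in perms L ->
    (\sum_(p < (size t).+1) inducible W (ins_at p x t) =
     inducible (W + <[x]>)%VS t + \sum_(i < size t) inducible W (mrg_at i x t))%N.
  rewrite mem_perms => tL; apply: (@count_ins_at _ _ d.+1); rewrite ?(perm_size tL) ?En //.
  by apply: gen_pos_perm g; rewrite perm_cons perm_sym.
rewrite big_perms_cons big_seq (eq_bigr _ step) -big_seq big_split /=.
rewrite (big_perms_mrg (fun t => nat_of_bool (inducible W t))).
have n1' : (1 < n)%N by apply: leq_ltn_trans dn.
have dW' : (\dim (W + <[x]>) + d <= \dim {:V})%N.
  by have [h _] := dimv_add_leqif W <[x]>%VS; have := dim_vline x; case: (x != 0); lia.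
have sW' : \sum_(y <- L) y \in (W + <[x]>)%VS.
  move: sW; rewrite big_cons => sW; rewrite -(addrK x (\sum_(y <- L) y)).
  rewrite [_ + x]addrC memvB //; first by rewrite (subvP (addvSl _ _)).
  by rewrite (subvP (addvSr _ _)) // memv_line.
rewrite PoszD (IH d _ _ En n1' (ltnW dn) dW' sW' (gen_pos_drop g)).
rewrite stirling_sumSS mulrDr; congr (_ + _).
have E (i : 'I_(size L)) : (\sum_(t <- perms (mrg_at i x L)) inducible W t)%:Z
    = 2 * stirling_sum n d.+1.
  apply: (IH d.+1) => //; first by rewrite size_mrg_at.
    by move: sW; rewrite sum_mrg_at // big_cons.
  exact: gen_pos_mrg.
rewrite (big_morph Posz PoszD (erefl _)) (eq_bigr _ (fun (i : 'I__) _ => E i)).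
by rewrite sumr_const card_ord En mulrCA [RHS]mulr_natl.
Qed.
End Count.

(** * From convex hulls of partial sums to orderings *)

Section Independence.
Variables (R : realFieldType) (d : nat).
Implicit Types (v : 'rV[R]_d).

Lemma row_free_span (p : 'I_d -> 'rV[R]_d) v : row_free (\matrix_(r < d) p r) ->
  exists w : 'I_d -> R, v = \sum_r w r *: p r.
Proof.
rewrite row_free_unit => U; exists (fun r => (v *m invmx (\matrix_(r < d) p r)) 0 r).
rewrite -[LHS](mulmxKV U) mulmx_sum_row; apply: eq_bigr => r _.
by rewrite rowK.
Qed.

Lemma row_free_eq0 (p : 'I_d -> 'rV[R]_d) (w : 'I_d -> R) :
  row_free (\matrix_(r < d) p r) -> \sum_r w r *: p r = 0 -> forall r, w r = 0.
Proof.
move=> /row_freeP[B MB] e r.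
have : (\row_r w r) *m \matrix_(r < d) p r = 0.
  by rewrite mulmx_sum_row -[RHS]e; apply: eq_bigr => i _; rewrite rowK mxE.
move=> /(congr1 (mulmx^~ B)); rewrite -mulmxA MB mulmx1 mul0mx.
by move/rowP/(_ r); rewrite !mxE.
Qed.

Definition any_free m (p : 'I_m -> 'rV[R]_d) :=
  forall k : 'I_d -> 'I_m, injective k -> row_free (\matrix_(r < d) p (k r)).

(** Strict positivity is reached by adding to [a] a small multiple of a relation that is 1 off the
    support of [a]. *)
Lemma pos_relation m (p : 'I_m -> 'rV[R]_d) (a : 'I_m -> R) : (d <= m)%N ->
  any_free p -> (forall k, 0 <= a k) -> \sum_k a k = 1 -> \sum_k a k *: p k = 0 ->
  exists2 b : 'I_m -> R, (forall k, 0 < b k) & \sum_k b k *: p k = 0.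
Proof.
move=> dm free a0 a1 ap.
(* The support comes first in [e], so the first [d] entries either lie in the support or contain it;
   if there are fewer than [d] support vectors, independence forces [a = 0]. *)
pose A := [pred k | 0 < a k]; pose e := enum A ++ enum [predC A].
have ue : uniq e.
  rewrite cat_uniq !enum_uniq andbT /=; apply/hasPn => k; rewrite !mem_enum inE.
  by move=> /negbTE ->.
have se : size e = m by rewrite size_cat -!cardE cardC card_ord.
case: m => [|m] in dm p a free a0 a1 ap A e ue se *.
  by move: a1; rewrite big_ord0 => /eqP; rewrite eq_sym oner_eq0.
pose k (r : 'I_d) : 'I_m.+1 := nth ord0 e r.
have re (r : 'I_d) : (r < size e)%N by rewrite se (leq_trans (ltn_ord r)).
have kinj : injective k.
  by move=> r s /eqP; rewrite nth_uniq ?re // => /eqP/val_inj.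
have {}free := free k kinj.
have [dA|Ad] := leqP d #|A|.
  have kA r : 0 < a (k r).
    have rA : (r < #|A|)%N by exact: leq_trans dA.
    have : k r \in enum A by rewrite /k nth_cat -cardE rA mem_nth // -cardE.
    by rewrite mem_enum.
  have [w vw] := row_free_span (\sum_(j | ~~ A j) p j) free.
  (* The vectors off the support are summed and rewritten in a basis taken from the support; hence
     [u] is 1 off it. *)
  pose u j : R := (~~ A j)%:R - \sum_r (k r == j)%:R * w r.
  have up : \sum_j u j *: p j = 0.
    have -> : \sum_j u j *: p j =
        \sum_j (~~ A j)%:R *: p j - \sum_j \sum_r ((k r == j)%:R * w r) *: p j.
      by rewrite -sumrB; apply: eq_bigr => j _; rewrite scalerBl scaler_suml.
    have -> : \sum_j (~~ A j)%:R *: p j = \sum_(j | ~~ A j) p j.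
      rewrite [RHS]big_mkcond; apply: eq_bigr => j _.
      by case: (A j); rewrite /= ?scale1r ?scale0r.
    rewrite vw exchange_big /=; apply/eqP; rewrite subr_eq0; apply/eqP.
    apply: eq_bigr => r _; rewrite (bigD1 (k r)) //= eqxx mul1r big1 ?addr0 //.
    by move=> j /negbTE ne; rewrite eq_sym ne mul0r scale0r.
  have [|h h0 hh] := @small_perturb R 'I_m.+1 (fun j => if A j then a j else 1)
      (fun j => if A j then u j else 0).
    by move=> j; case: ifP.
  exists (fun j => a j + h * u j).
    move=> j; have := hh h; rewrite gtr0_norm // lexx => /(_ isT j).
    case: ifP => // Aj _; rewrite (_ : u j = 1).
      by rewrite mulr1 ltr_wpDl.
    rewrite /u Aj big1 ?subr0 // => r _; case: eqP => [kj|_]; last by rewrite mul0r.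
    by move: (kA r); rewrite kj => /idP; rewrite -[0 < _]/(A j) Aj.
  under eq_bigr => j _ do rewrite scalerDl -scalerA.
  by rewrite big_split /= ap add0r -scaler_sumr up scaler0.
have sub j : 0 < a j -> exists r, j = k r.
  move=> aj; have jA : j \in enum A by rewrite mem_enum.
  have idx : (index j (enum A) < d)%N by rewrite (ltn_trans _ Ad) // cardE index_mem.
  exists (Ordinal idx); rewrite /k nth_cat index_mem jA nth_index //.
have : \sum_r a (k r) *: p (k r) = 0.
  have := @big_imset _ 0 +%R _ _ k [set: 'I_d]%SET (fun j => a j *: p j)
    (fun r s _ _ => @kinj r s).
  rewrite [X in _ = X](eq_bigl xpredT); last by move=> r; rewrite inE.
  move=> <-; rewrite -[RHS]ap [LHS]big_mkcond; apply: eq_bigr => j _; case: ifP => // jk.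
  have : ~~ (0 < a j).
    by apply/negP => /sub[r jr]; move: jk; rewrite jr imset_f ?inE.
  by rewrite lt_neqAle a0 andbT negbK => /eqP <-; rewrite scale0r.
move/(row_free_eq0 (w := fun r => a (k r)) free) => ak0.
move: a1; rewrite big1 => [/eqP|j _]; first by rewrite eq_sym oner_eq0.
apply/eqP; rewrite eq_le a0 andbT leNgt; apply/negP => aj.
by have [r jr] := sub j aj; move: aj; rewrite jr ak0 ltxx.
Qed.
End Independence.

(** * Partial sums and relations between the steps *)

Section PartialSums.
Variables (R : realFieldType) (d n : nat).
Implicit Types (x : 'I_n -> 'rV[R]_d).

Definition partial_sum x k := \sum_(i < n | (i < k)%N) x i.

Definition walk x := [seq x i | i <- enum 'I_n].

Lemma size_walk x : size (walk x) = n.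
Proof. by rewrite size_map size_enum_ord. Qed.

Lemma big_walk x : \sum_(v <- walk x) v = \sum_i x i.
Proof. by rewrite big_map big_enum. Qed.

Lemma dot_walk (c : nat -> R) x : dot c (walk x) = \sum_(i < n) c i *: x i.
Proof.
rewrite /dot size_walk; apply: eq_bigr => i _.
by rewrite (nth_map i) ?size_enum_ord // nth_ord_enum.
Qed.

(** Summation by parts. As [k] stays below [n.-1], the coefficient of the last step is an empty sum,
    that is 0. *)
Lemma abel_sum (a : 'I_n.-1 -> R) x :
  \sum_k a k *: partial_sum x k.+1 = \sum_(i < n) (\sum_(k < n.-1 | (i <= k)%N) a k) *: x i.
Proof.
under eq_bigr => k _ do rewrite scaler_sumr.
rewrite (exchange_big_dep predT) //=; apply: eq_bigr => i _.
by rewrite scaler_suml.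
Qed.

Lemma sum_gap (c : nat -> R) i : (i < n)%N ->
  \sum_(k < n.-1 | (i <= k)%N) (c k - c k.+1) = c i - c n.-1.
Proof.
move=> lin; have le : (i <= n.-1)%N by lia.
rewrite -(big_mkord (fun k => i <= k)%N (fun k => c k - c k.+1)).
rewrite (big_cat_nat _ le) //= [X in X + _]big_nat_cond big1 ?add0r; last by move=> k; lia.
rewrite big_nat_cond (eq_bigl (fun k => (i <= k < n.-1)%N)); last by move=> k; lia.
rewrite -big_nat -[RHS]opprB -(telescope_sumr c le) -sumrN.
by apply: eq_bigr => k _; rewrite opprB.
Qed.

(** Tail sums of positive weights decrease strictly; conversely the gaps of a strictly decreasing
    relation are positive weights. The gaps only recover [c] minus the constant [c n.-1], which
    multiplies the zero total. *)
Lemma conv_inducible x : (1 < n)%N -> (d < n)%N -> \sum_i x i = 0 ->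
  any_free (fun k : 'I_n.-1 => partial_sum x k.+1) ->
  (exists a : 'I_n.-1 -> R, (forall k, 0 <= a k) /\ \sum_k a k = 1 /\
     \sum_k a k *: partial_sum x k.+1 = 0) <-> inducible 0%VS (walk x).
Proof.
move=> n1 dn x0 free; split.
  move=> [a [a0 [a1 ap]]].
  have dn' : (d <= n.-1)%N by lia.
  have [b b0 bp] := pos_relation dn' free a0 a1 ap.
  apply/asboolP; exists (fun i => \sum_(k < n.-1 | (i <= k)%N) b k).
  rewrite size_walk dot_walk -abel_sum bp mem0v; split => // i j /andP[ij jn].
  have lin : (i < n.-1)%N by lia.
  rewrite [ltRHS](bigID (fun k : 'I_n.-1 => j <= k)%N) /=.
  rewrite (eq_bigl (fun k : 'I_n.-1 => (i <= k) && (j <= k))%N); last by move=> k; lia.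
  rewrite ltrDl (bigD1 (Ordinal lin)) /=; last by rewrite leqnn -ltnNge.
  by rewrite ltr_pwDl // sumr_ge0 // => k _; apply/ltW.
move=> /asboolP[c [dc]]; rewrite size_walk in dc; rewrite dot_walk memv0 => /eqP cx.
pose a (k : 'I_n.-1) := c k - c k.+1.
have a0 k : 0 < a k by rewrite subr_gt0 dc //; have := ltn_ord k; lia.
have lin : (0 < n.-1)%N by lia.
have T0 : 0 < \sum_k a k.
  rewrite (bigD1 (Ordinal lin)) //= ltr_pwDl // sumr_ge0 // => k _; exact/ltW.
have ap : \sum_k a k *: partial_sum x k.+1 = 0.
  rewrite abel_sum (eq_bigr (fun i : 'I_n => c i *: x i - c n.-1 *: x i)).
    by rewrite sumrB cx -scaler_sumr x0 scaler0 subrr.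
  by move=> i _; rewrite sum_gap // scalerBl.
exists (fun k => (\sum_k a k)^-1 * a k); split; last split.
- by move=> k; rewrite mulr_ge0 ?invr_ge0 // ltW.
- by rewrite -mulr_sumr mulVf // gt_eqF.
- under eq_bigr => k _ do rewrite -scalerA.
  by rewrite -scaler_sumr ap scaler0.
Qed.

Lemma sorted_filter_take (A : Type) (P : seq (nat * A)) j :
  sorted (fun p q => p.1 <= q.1)%N P ->
  [seq p <- P | (p.1 <= j)%N] = take (count (fun p => p.1 <= j)%N P) P.
Proof.
elim: P => //= p P IH pP; have := order_path_min _ pP => ap.
have {}ap : all (fun q => p.1 <= q.1)%N P by apply: ap => ? ? ?; exact: leq_trans.
case: leqP => pj; first by rewrite IH //= ; exact: path_sorted pP.
have cP : count (fun q => q.1 <= j)%N P = 0%N.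
  apply/eqP; rewrite -leqn0 leqNgt -has_count.
  elim: P ap {IH pP} => //= q P IH /andP[pq /IH nh]; rewrite negb_or nh andbT.
  by rewrite -ltnNge (leq_trans pj).
rewrite cP addn0 take0; apply: size0nil; by rewrite size_filter.
Qed.

(** After sorting by colour, the vectors of colour at most [j] are an initial stretch of a permuted
    walk, and their sum is one of its partial sums. *)
Lemma any_free_gen_pos x :
  (forall s : 'S_n, any_free (fun k : 'I_n.-1 => partial_sum (fun i => x (s i)) k.+1)) ->
  gen_pos d 0%VS (walk x).
Proof.
move=> free P PL sub v.
pose P' := sort (fun p q : nat * 'rV[R]_d => p.1 <= q.1)%N P.
have PP' : perm_eq P' P by rewrite perm_sort.
have srt : sorted (fun p q : nat * 'rV[R]_d => p.1 <= q.1)%N P'.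
  by apply: sort_sorted => p q; exact: leq_total.
have [s us] : exists s : 'S_n, unzip2 P' = walk (fun i => x (s i)).
  have /tuple_permP[s us] : perm_eq (unzip2 P') [tuple x i | i < n].
    by rewrite (perm_trans (perm_map _ PP')) // (perm_trans PL).
  exists s; rewrite us /=; apply: eq_map => i; exact: tnth_mktuple.
have sP' : size P' = n by rewrite -(size_map snd) -/(unzip2 P') us size_walk.
(* As the colours 0 to [d] occur, [0 < ct 0 < ... < ct d <= n]; so [ct j] for [j < d] gives [d]
   distinct indices among 1 to [n - 1]. *)
pose ct j := count (fun p : nat * 'rV[R]_d => p.1 <= j)%N P'.
have col j : (j <= d)%N -> exists2 p, p \in P' & p.1 = j.
  move=> jd; have /sub : j \in iota 0 d.+1 by rewrite mem_iota.
  by case/mapP => p pP ->; exists p; rewrite // (perm_mem PP').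
have ct_lt i j : (i < j <= d)%N -> (ct i < ct j)%N.
  move=> /andP[ij jd]; have [p pP pj] := col j jd.
  have : (0 < count (fun p : nat * 'rV[R]_d => p.1 == j) P')%N.
    by rewrite -has_count; apply/hasP; exists p; rewrite ?pj.
  rewrite /ct (_ : count (fun p => p.1 <= j)%N P' =
    (count (fun p => p.1 <= i)%N P' +
     count (predI (fun p => p.1 <= j)%N (predC (fun p => p.1 <= i)%N)) P')%N).
    move=> c0; rewrite -[X in (X < _)%N]addn0 ltn_add2l (leq_trans c0) //.
    by apply: sub_count => q /= /eqP ->; rewrite leqnn -ltnNge.
  rewrite -[LHS]size_filter -(count_predC (fun p : nat * 'rV[R]_d => p.1 <= i)%N
    [seq p <- P' | (p.1 <= j)%N]) !count_filter.
  by congr (_ + _)%N; apply: eq_count => q /=; lia.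
have ct_gt0 j : (0 < ct j)%N.
  have [p pP p0] := col 0%N isT.
  by rewrite -has_count; apply/hasP; exists p; rewrite ?p0.
have ct_n (j : 'I_d) : (ct j < n)%N.
  by apply: (@leq_trans (ct d)); rewrite ?ct_lt ?ltn_ord ?leqnn // -sP' count_size.
have klt (j : 'I_d) : ((ct j).-1 < n.-1)%N by rewrite ltn_predRL prednK ?ct_n.
pose k (j : 'I_d) : 'I_n.-1 := Ordinal (klt j).
have kS j : (k j).+1 = ct j by rewrite prednK.
have kinj : injective k.
  move=> i j /(congr1 val) /= e.
  have {}e : ct i = ct j by rewrite -!kS /= e.
  apply: val_inj; case: (ltngtP (val i) (val j)) => // ij.
    by have := @ct_lt i j; rewrite ij ltnW //= e ltnn => /(_ isT).
  by have := @ct_lt j i; rewrite ij ltnW //= e ltnn => /(_ isT).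
have psE (j : 'I_d) : partial_sum (fun i => x (s i)) (k j).+1 = \sum_(p <- P | (p.1 <= j)%N) p.2.
  rewrite kS -(perm_big _ PP') -big_filter sorted_filter_take // -/(ct j).
  rewrite -(big_map snd xpredT id) map_take -/(unzip2 P') us.
  rewrite (big_nth 0) size_takel ?size_walk 1?ltnW // big_mkord.
  have ctn := ltnW (ct_n j).
  rewrite (big_ord_widen n (fun i => (take (ct j) (walk (fun i => x (s i))))`_i) ctn).
  apply: eq_bigr => i ij; rewrite nth_take // (nth_map i) ?size_enum_ord //.
  by rewrite nth_ord_enum.
have [w ->] := row_free_span v (free s k kinj).
(* A class receives the weights of all the partial sums that contain it; colours from [d] on receive
   0. *)
exists (fun c => \sum_(j < d | (c <= j)%N) w j).
under eq_bigr => j _ do rewrite psE scaler_sumr.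
rewrite (exchange_big_dep predT) //=.
under [X in _ - X]eq_bigr => p _ do rewrite scaler_suml.
by rewrite subrr mem0v.
Qed.
End PartialSums.

(** * Fourier-Motzkin elimination with rational certificates *)

Section Gordan.
Variable R : realType.

Lemma seq_max (s : seq R) (x : R) : exists2 m, m \in x :: s & {in x :: s, forall z, z <= m}.
Proof.
elim: s x => [|y s IH] x.
  by exists x; rewrite ?mem_head // => z; rewrite inE => /eqP ->.
have [m ms mM] := IH y; have [xm|mx] := leP x m.
  exists m; first by rewrite inE ms orbT.
  by move=> z; rewrite inE => /predU1P[->//|/mM].
exists x; rewrite ?mem_head // => z; rewrite inE => /predU1P[->//|/mM zm].
exact: le_trans zm (ltW mx).
Qed.

Lemma rat_separation (lo up : seq R) : {in lo & up, forall l u, l < u} ->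
  exists t : rat, {in lo, forall l, l < ratr t} /\ {in up, forall u, ratr t < u}.
Proof.
move=> sep.
have [a [b [ab la bu]]] : exists a b : R, [/\ a < b, {in lo, forall l, l <= a} &
    {in up, forall u, b <= u}].
  have min_up x s : exists2 m : R, m \in x :: s & {in x :: s, forall z, m <= z}.
    have [m ms mM] := seq_max (map -%R s) (- x); exists (- m).
      move: ms; rewrite -map_cons => /mapP[z zs ->]; by rewrite opprK.
    move=> z zs; rewrite lerNl; apply: mM; rewrite -map_cons; exact: map_f.
  case: lo sep => [|x lo] sep; case: up sep => [|y up] sep.
  - by exists 0, 1; split.
  - by have [m _ mm] := min_up y up; exists (m - 1), m; split => //; rewrite ltrBlDr ltrDl.
  - by have [m _ mm] := seq_max lo x; exists m, (m + 1); split => //; rewrite ltrDl.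
  - have [m mi mm] := seq_max lo x; have [m' mi' mm'] := min_up y up.
    by exists m, m'; split => //; exact: sep.
have [t tab] := rat_in_itvoo ab; move: tab; rewrite in_itv /= => /andP[at_ tb].
exists t; split => [l /la h|u /bu h]; first exact: le_lt_trans at_.
exact: lt_le_trans h.
Qed.

(* Fourier-Motzkin elimination of the last coordinate; only the cone property of
   [C] is needed to keep track of the combinations that are formed. *)
Lemma gordan_cone d (I : finType) (Q : pred I) (p : I -> nat -> R) (C : (nat -> R) -> Prop) :
  (forall u v a b, 0 < a -> 0 < b -> C u -> C v -> C (fun j => a * u j + b * v j)) ->
  (forall i, Q i -> C (p i)) ->
  (exists2 v, C v & forall j, (j < d)%N -> v j = 0) \/
  (exists y : nat -> rat, forall i, Q i -> 0 < \sum_(j < d) p i j * ratr (y j)).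
Proof.
elim: d I Q p C => [|d IH] I Q p C cone Cp.
  have [i Qi|Q0] := pickP Q; first by left; exists (p i); [exact: Cp|].
  by right; exists (fun=> 0) => i; rewrite Q0.
pose Q' (k : I + I * I) := match k with
  | inl i => Q i && (p i d == 0)
  | inr (i, j) => [&& Q i, Q j, 0 < p i d & p j d < 0] end.
pose p' (k : I + I * I) := match k with
  | inl i => p i
  | inr (i, j) => fun l => - p j d * p i l + p i d * p j l end.
have [||[v [Cv vd] v0]|[y hy]] := IH _ Q' p' (fun v => C v /\ v d = 0).
- move=> u v a b a0 b0 [Cu ud] [Cv vd]; split; first exact: cone.
  by rewrite ud vd !mulr0 addr0.
- move=> [i /andP[Qi /eqP pi]|[i j] /and4P[Qi Qj pi pj]]; first by split; [exact: Cp|].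
  split; last by rewrite /= mulNr [p i d * _]mulrC addNr.
  by apply: cone; rewrite ?oppr_gt0 //; apply: Cp.
- left; exists v => // j; rewrite ltnS leq_eqVlt => /orP[/eqP ->//|]; exact: v0.
right; pose g i := \sum_(j < d) p i j * ratr (y j).
(* The new coordinate [y d] must exceed [lo] and stay below [up]; the inequalities for the pairs say
   that [lo] lies below [up]. *)
pose lo := [seq - g i / p i d | i <- enum I & Q i && (0 < p i d)].
pose up := [seq g i / - p i d | i <- enum I & Q i && (p i d < 0)].
have [l u|t [tlo tup]] := @rat_separation lo up.
  move=> /mapP[i]; rewrite mem_filter => /andP[/andP[Qi pi] _] ->.
  move=> /mapP[j]; rewrite mem_filter => /andP[/andP[Qj pj] _] ->.
  have := hy (inr (i, j)); rewrite /= Qi Qj pi pj => /(_ isT).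
  under eq_bigr => k _ do rewrite mulrDl -!mulrA.
  rewrite big_split /= -!mulr_sumr -/(g i) -/(g j) => h.
  rewrite ltr_pdivrMr // mulrAC ltr_pdivlMr ?oppr_gt0 //; lra.
exists (fun j => if j == d then t else y j) => i Qi.
rewrite big_ord_recr /= eqxx (eq_bigr (fun j : 'I_d => p i j * ratr (y j))); last first.
  by move=> j _; rewrite ltn_eqF.
rewrite -/(g i); have [pi|pi|pi] := ltgtP (p i d) 0.
- have : ratr t < g i / - p i d.
    by apply/tup/map_f; rewrite mem_filter Qi pi mem_enum.
  by rewrite ltr_pdivlMr ?oppr_gt0 //; lra.
- have : - g i / p i d < ratr t.
    by apply/tlo/map_f; rewrite mem_filter Qi pi mem_enum.
  by rewrite ltr_pdivrMr //; lra.
- by have := hy (inl i); rewrite /= Qi pi eqxx mul0r addr0 => /(_ isT).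
Qed.

(** The cone [C] holds the combinations with nonnegative weights of positive total, so a zero vector
    in it becomes a convex combination after scaling. *)
Lemma gordan d m (p : 'I_m -> 'rV[R]_d) :
  ~ in_conv p 0 <-> exists y : {ffun 'I_d -> rat}, forall k, 0 < \sum_j p k 0 j * ratr (y j).
Proof.
split; last first.
  move=> [y hy] [a [a0 [a1 ap]]].
  have : \sum_k a k * (\sum_j p k 0 j * ratr (y j)) = 0.
    under eq_bigr => k _ do rewrite mulr_sumr.
    rewrite exchange_big big1 //= => j _.
    under eq_bigr => k _ do rewrite mulrA.
    rewrite -mulr_suml (_ : \sum_k _ = 0) ?mul0r //.
    move/rowP: ap => /(_ j); rewrite summxE [RHS]mxE => e; rewrite -[RHS]e.
    by apply: eq_bigr => k _; rewrite mxE.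
  have [k ak] : exists k, 0 < a k.
    apply/existsP; apply: contraT => /existsPn n0; move: a1; rewrite big1.
      by move/eqP; rewrite eq_sym oner_eq0.
    by move=> k _; apply/eqP; rewrite eq_le a0 andbT leNgt n0.
  apply/eqP; rewrite gt_eqF // (bigD1 k) //= ltr_pwDl ?mulr_gt0 //.
  by apply: sumr_ge0 => l _; rewrite mulr_ge0 // ltW.
move=> nconv.
pose q k j : R := oapp (p k 0) 0 (insub j : option 'I_d).
have qE k (j : 'I_d) : q k j = p k 0 j by rewrite /q valK.
pose C v := exists a : 'I_m -> R, [/\ forall k, 0 <= a k, 0 < \sum_k a k &
  forall j, v j = \sum_k a k * q k j].
have [||[v [a [a0 a1 av]] v0]|[y hy]] := @gordan_cone d 'I_m predT q C.
- move=> u v a b a0 b0 [f [f0 f1 fu]] [g [g0 g1 gv]].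
  exists (fun k => a * f k + b * g k); split.
  + by move=> k; rewrite addr_ge0 // mulr_ge0 // ltW.
  + by rewrite big_split /= -!mulr_sumr addr_gt0 // mulr_gt0.
  + move=> j; rewrite fu gv !mulr_sumr -big_split; apply: eq_bigr => k _.
    by rewrite mulrDl !mulrA.
- move=> k _; exists (fun l => (l == k)%:R); split => //.
  + by rewrite (bigD1 k) //= eqxx ltr_pwDl // sumr_ge0.
  + move=> j; rewrite (bigD1 k) //= eqxx mul1r big1 ?addr0 // => l /negbTE ->.
    by rewrite mul0r.
- case: nconv; exists (fun k => (\sum_l a l)^-1 * a k); split; last split.
  + by move=> k; rewrite mulr_ge0 // invr_ge0 ltW.
  + by rewrite -mulr_sumr mulVf // gt_eqF.
  + under eq_bigr => k _ do rewrite -scalerA.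
    rewrite -scaler_sumr (_ : \sum_k a k *: p k = 0) ?scaler0 //.
    apply/rowP => j; rewrite summxE mxE -[RHS](v0 j) // av.
    by apply: eq_bigr => k _; rewrite mxE qE.
- exists [ffun j => y (val j)] => k; have := hy k isT.
  by under eq_bigr => j _ do rewrite qE; under [X in _ -> _ < X]eq_bigr => j _ do rewrite ffunE.
Qed.
End Gordan.

(** * Measurability and exchangeability *)

Section Measurability.
Import numFieldNormedType.Exports.
Variables (R : realType) (n d : nat).

Let MT : measurableType _ := g_sigma_algebraType (@mx_coord_sets R n d).

Lemma measurable_coord i j : measurable_fun setT (fun M : MT => M i j : R).
Proof.
move=> _ B mB; rewrite setTI; apply: sub_sigma_algebra.
by exists i, j, B.
Qed.

Let rows (M : 'M[R]_(n, d)) (i : 'I_n) := row i M.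

Lemma measurable_partial_sum k j :
  measurable_fun setT (fun M : MT => partial_sum (rows M) k 0 j : R).
Proof.
rewrite (_ : (fun M : MT => _) = fun M : MT =>
    \sum_(i <- [seq i : 'I_n <- index_enum 'I_n | (i < k)%N]) (M i j : R)).
  by apply: measurable_sum => i; exact: measurable_coord.
apply/funext => M; rewrite /partial_sum summxE big_filter.
by apply: eq_bigr => i _; rewrite mxE.
Qed.

Definition conv_set : set 'M[R]_(n, d) :=
  [set M | in_conv (fun k : 'I_n.-1 => partial_sum (rows M) k.+1) 0].

(** By [gordan] the complement is a union, over the countably many rational functionals, of finite
    intersections of strict inequalities. *)
Lemma measurable_conv_set : mx_borel conv_set.
Proof.
rewrite -[conv_set]setCK.
suff mC : @measurable _ MT (~` conv_set) by exact: (measurableC mC).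
rewrite (_ : ~` conv_set = \bigcup_(y : {ffun 'I_d -> rat})
    \bigcap_(k : 'I_n.-1)
      [set M : MT | 0 < \sum_j partial_sum (rows M) k.+1 0 j * ratr (y j)]);
  last first.
  apply/seteqP; split => M /=.
    by move=> /gordan[y hy]; exists y => // k _; exact: hy.
  by move=> [y _ hy]; apply/gordan; exists y => k; exact: hy.
apply: countable_bigcupT_measurable => [|y]; first exact: countableP.
apply: fin_bigcap_measurable => // k _.
rewrite -[X in measurable X]setTI.
have mf : measurable_fun setT
    (fun M : MT => \sum_j partial_sum (rows M) k.+1 0 j * ratr (y j) : R).
  apply: measurable_sum => j; apply: measurable_funM => //.
  exact: measurable_partial_sum.
have -> : [set M : MT | 0 < \sum_j partial_sum (rows M) k.+1 0 j * ratr (y j)] =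
  (fun M : MT => \sum_j partial_sum (rows M) k.+1 0 j * ratr (y j) : R) @^-1` `]0, +oo[%classic.
  by apply/seteqP; split => M /=; rewrite in_itv /= andbT.
by apply: mf => //; exact: measurable_itv.
Qed.

Definition free_set (k : 'I_d -> 'I_n.-1) : set 'M[R]_(n, d) :=
  [set M | row_free (\matrix_(r < d) partial_sum (rows M) (k r).+1)].

(** Independence of [d] vectors in dimension [d] means a nonzero determinant, which is a polynomial
    in the entries. *)
Lemma measurable_free_set k : mx_borel (free_set k).
Proof.
pose D (M : MT) : R := \det (\matrix_(r < d) partial_sum (rows M) (k r).+1).
have mD : measurable_fun setT D.
  rewrite /D /determinant; apply: measurable_sum => s; apply: measurable_funM => //.
  apply: measurable_prod => r _.
  rewrite (_ : (fun M : MT => _) = fun M : MT => partial_sum (rows M) (k r).+1 0 (s r) : R).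
    exact: measurable_partial_sum.
  by apply/funext => M; rewrite mxE.
have -> : free_set k = setT `&` D @^-1` (~` [set 0]).
  apply/seteqP; split => M; rewrite /free_set /= row_free_unit unitmxE unitfE.
    by move=> /eqP.
  by move=> [_ /eqP].
by apply: mD => //; apply: measurableC.
Qed.
End Measurability.

(** * Exchangeability and almost sure counts *)

Section Randomness.
Import numFieldNormedType.Exports.
Variables (d0 : measure_display) (T : measurableType d0) (R : realType).
Variables (P : probability T R) (d n : nat) (xi : 'I_n -> T -> 'rV[R]_d).
Hypothesis mxi : forall (i : 'I_n) (j : 'I_d), measurable_fun setT (fun w => xi i w 0 j).

Lemma measurable_tuple_mx s A : mx_borel A -> measurable (tuple_mx xi s @^-1` A).
Proof.
move=> mA.
have m : @measurable_fun _ _ T (g_sigma_algebraType (@mx_coord_sets R n d)) setT (tuple_mx xi s).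
  apply: (@measurability _ _ T (g_sigma_algebraType (@mx_coord_sets R n d)) setT
    (tuple_mx xi s) (@mx_coord_sets R n d)) => //.
  move=> _ [_ [i [j [B [mB ->]]]] <-]; rewrite setTI.
  have := @mxi (s i) j measurableT B mB; rewrite setTI.
  by congr measurable; apply/seteqP; split => w /=; rewrite mxE.
by rewrite -[X in measurable X]setTI; exact: m.
Qed.

Lemma row_tuple_mx s w : (fun i => row i (tuple_mx xi s w)) = fun i => xi (s i) w.
Proof. by apply/funext => i; apply/rowP => j; rewrite !mxE. Qed.

(** The complement of [A] has probability 0 for the given order and hence, by exchangeability, for
    every order. *)
Lemma exchangeable_ae A : exchangeable P xi -> mx_borel A ->
  {ae P, forall w, A (tuple_mx xi 1%g w)} ->
  forall s, {ae P, forall w, A (tuple_mx xi s w)}.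
Proof.
move=> exch mA ae1 s.
have mCA : mx_borel (~` A) by exact: (@measurableC _ (g_sigma_algebraType (@mx_coord_sets R n d))).
have mT u : measurable (tuple_mx xi u @^-1` (~` A)) by exact: measurable_tuple_mx.
suff : P.-negligible (tuple_mx xi s @^-1` (~` A)) by [].
apply/(negligibleP _ (mT s)); apply: etrans (esym (exch s _ mCA)) _.
by apply/(negligibleP _ (mT 1%g)); exact: ae1.
Qed.

Lemma ae_any_free : exchangeable P xi ->
  (forall k : 'I_d -> 'I_n.-1, injective k ->
     {ae P, forall w, row_free (\matrix_(r < d) psum xi (k r).+1 w)}) ->
  {ae P, forall w, forall s : {perm 'I_n},
    any_free (fun k : 'I_n.-1 => partial_sum (fun i => xi (s i) w) k.+1)}.
Proof.
move=> exch free.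
(* Selections are taken in a finite function type, so that both quantifiers are finite and pass
   inside the almost sure statement. *)
have : {ae P, forall w, forall (s : {perm 'I_n}) (k : {ffun 'I_d -> 'I_n.-1}),
    injective k -> free_set k (tuple_mx xi s w)}.
  apply: filter_forall => s; apply: filter_forall => k.
  have [kinj|nk] := pselect (injective k); last by apply: nearW => w /nk.
  have ae1 : {ae P, forall w, free_set k (tuple_mx xi 1%g w)}.
    apply: filterS (free k kinj) => w.
    rewrite /free_set /= row_tuple_mx (_ : (fun i => _) = fun i => xi i w) //.
    by apply/funext => i; rewrite perm1.
  have := exchangeable_ae exch (@measurable_free_set R n d k) ae1 s.
  by apply: filterS => w h _.
apply: filterS => w h s k kinj.
have := h s (finfun k); rewrite /free_set /= row_tuple_mx.
rewrite (_ : \matrix_r _ = \matrix_(r < d) partial_sum (fun i => xi (s i) w) (k r).+1); last first.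
  by apply/row_matrixP => r; rewrite !rowK ffunE.
by apply => r1 r2; rewrite !ffunE; exact: kinj.
Qed.

(** Both sides are the expected number of the events [A i] that occur. *)
Lemma sum_probability_count (I : finType) (A : I -> set T) (N : nat) :
  (forall i, measurable (A i)) ->
  {ae P, forall w, (\sum_i (w \in A i) = N)%N} ->
  (\sum_i P (A i) = N%:R%:E)%E.
Proof.
move=> mA aeN.
have mf i : measurable_fun setT (fun w => (\1_(A i) w)%:E : \bar R).
  by apply/measurable_EFinP; exact: measurable_indic.
transitivity (\int[P]_w (\sum_i (\1_(A i) w)%:E))%E.
  rewrite ge0_integral_sum //.
  by apply: eq_bigr => i _; rewrite integral_indic // setIT.
rewrite (@ae_eq_integral _ _ _ _ _ (cst N%:R%:E)) //.
- by rewrite integral_cst // [X in (_ * X)%E](_ : _ = 1%E) ?mule1 //; exact: probability_setT.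
- exact: emeasurable_sum.
- apply: filterS aeN => w eN _; rewrite sumEFin -eN natr_sum; congr EFin.
Qed.
End Randomness.

Theorem theorem2p1 (d0 : measure_display) (T : measurableType d0) (R : realType)
  (P : probability T R) (d n : nat) (xi : 'I_n -> T -> 'rV[R]_d) :
  (1 <= d)%N -> (d.+1 <= n)%N ->
  (forall (i : 'I_n) (j : 'I_d), measurable_fun setT (fun w => xi i w 0 j)) ->
  exchangeable P xi ->
  {ae P, forall w, psum xi n w = 0} ->
  (forall k : 'I_d -> 'I_n.-1, injective k ->
     {ae P, forall w, row_free (\matrix_(r < d) psum xi (k r).+1 w)}) ->
  P [set w | in_conv (fun k : 'I_n.-1 => psum xi k.+1 w) 0] =
  ((2 / (n`!)%:R) *
     \sum_(k < n.+1 | (d.+2 <= k)%N && ~~ odd (k - d)) (stirling1 n k)%:~R)%:E.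
Proof.
move=> d1 dn mxi exch ae0 free.
have n1 : (1 < n)%N by lia.
set A := [set w | _].
(* [B s] is the event for the steps in the order [s]. These [n!] events are equally likely, and
   their probabilities add up to the almost surely constant number [N] of those that occur. *)
pose B (s : {perm 'I_n}) := tuple_mx xi s @^-1` @conv_set R n d.
have mB s : measurable (B s).
  by apply: measurable_tuple_mx => //; exact: measurable_conv_set.
have AB : A = B 1%g.
  have e1 w : (fun i => xi ((1%g : {perm 'I_n}) i) w) = fun i => xi i w.
    by apply/funext => i; rewrite perm1.
  by apply/seteqP; split => w; rewrite /A /B /conv_set /= row_tuple_mx e1.
have mA : measurable A by rewrite AB.
have PB s : P (B s) = P A by rewrite AB /B -exch //; exact: measurable_conv_set.
pose N : nat := absz (2 * stirling_sum n d).
have aeN : {ae P, forall w, (\sum_s (w \in B s) = N)%N /\ 2 * stirling_sum n d = N%:Z}.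
  apply: filterS2 ae0 (ae_any_free mxi exch free) => w s0 fr.
  pose x i := xi i w.
  have x0 : \sum_i x i = 0.
    by rewrite -[RHS]s0; apply: eq_bigl => i; rewrite ltn_ord.
  have g : gen_pos d 0%VS (walk x) by exact: any_free_gen_pos.
  have := @count_inducible _ _ d 0%VS (walk x).
  rewrite size_walk big_walk x0 mem0v dimv0 dimvf dim_matrix => /(_ n1 dn).
  rewrite add0n mul1r leqnn => /(_ isT isT g) cE.
  have E : (\sum_s (w \in B s) = \sum_(t <- perms (walk x)) inducible 0%VS t)%N.
    rewrite big_perms_enum; apply: eq_bigr => s _; congr nat_of_bool.
    have xs0 : \sum_i x (s i) = 0.
      by rewrite -[RHS]x0 [RHS](reindex_inj (@perm_inj _ s)).
    apply/idP/idP; rewrite inE /B /conv_set /= row_tuple_mx.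
      by move=> /(conv_inducible n1 dn xs0 (fr s)).
    by move=> /(conv_inducible n1 dn xs0 (fr s)).
  by rewrite E /N -cE absz_nat; exact: conj erefl erefl.
(* A single good sample point shows that twice the Stirling sum is a cardinality, hence equal to [N]
   with no change of sign. *)
have [w [_ EN]] : exists w, (\sum_s (w \in B s) = N)%N /\ 2 * stirling_sum n d = N%:Z.
  have PT : (0 < P setT)%E by rewrite [X in (_ < X)%E](_ : _ = 1%E) //; exact: probability_setT.
  exact: (@filter_ex _ _ (ae_properfilter_algebraOfSetsType PT) _ aeN).
have {}aeN : {ae P, forall w, (\sum_s (w \in B s) = N)%N} by apply: filterS aeN => ? [].
have := sum_probability_count mB aeN.
rewrite (eq_bigr _ (fun s _ => PB s)) -(fineK (fin_num_measure P _ mA)).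
rewrite sumEFin sumr_const (_ : #|_| = n`!); last exact: card_Sn.
move=> /(congr1 (@fine _)) /= PN.
congr EFin; apply: (@mulIf _ (n`!%:R)); first by rewrite pnatr_eq0 -lt0n fact_gt0.
rewrite mulr_natr PN mulrAC divfK ?pnatr_eq0 -?lt0n ?fact_gt0 //.
have -> : N%:R = (N%:Z)%:~R :> R by [].
by rewrite -EN rmorphM /= /stirling_sum rmorph_sum.
Qed.
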